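(* Assume that the standing assumptions (A1)--(A5) on $(f_0,f_1,\phi_0,\phi_1)$ hold, let $\{x_k\}$ be the sequence of iterates generated by the inexact trust-region algorithm (both described in the context), and suppose $\sum_{k=1}^\infty (1+\max_{j=1,\ldots,k}\|B_j\|_{\mathcal{L}(X)})^{-1}=+\infty$. Moreover, suppose there exist $\bar x\in X$ (with $\bar x\in U\cap V$) and an infinite index set $\mathcal{K}\subseteq\mathbb{N}$ such that $h_k\to0$ and $x_k\to\bar x$ strongly in $X$ as $\mathcal{K}\ni k\to\infty$. If there exists $t_{\max}>0$ with $t_k\le t_{\max}$ for all $k$, then $\bar x$ is a stationary point of $\min_{x\in X}J(x)$. In particular, for all $t>0$, $$\exists\,\bar\theta\in\partial\phi_1(f_1(\bar x))\quad\text{such that}\quad \bar x=\mathrm{prox}_{t\phi_0}\big(\bar x-t(\nabla f_0(\bar x)+f_1'(\bar x)^*\bar\theta)\big).$$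
   Context: $X,Y$ are real Hilbert spaces, identified with their duals; $\mathcal{L}(X,Y)$ is the space of bounded linear operators with the operator norm, $\mathcal{L}(X)=\mathcal{L}(X,X)$, and $A^*\in\mathcal{L}(Y,X)$ is the Hilbert adjoint of $A\in\mathcal{L}(X,Y)$. For a proper closed convex $\psi$, $\mathrm{dom}\,\psi=\{x:\psi(x)<+\infty\}$, $\partial\psi$ is the convex subdifferential, and $\mathrm{prox}_{\psi}(x)=\arg\min_{x'}\{\frac12\|x'-x\|^2+\psi(x')\}$. Problem: minimize $J(x)=f_0(x)+\phi_1(f_1(x))+\phi_0(x)$ over $x\in X$. A point $\bar x$ is called stationary if there is $\bar\theta\in\partial\phi_1(f_1(\bar x))$ with $-(\nabla f_0(\bar x)+f_1'(\bar x)^*\bar\theta)\in\partial\phi_0(\bar x)$. Standing assumptions: (A1) $\phi_0:X\to(-\infty,+\infty]$ is proper, closed and convex. (A2) $f_0:X\to\mathbb{R}$, and there is an open set $U\supseteq\mathrm{dom}\,\phi_0$ on which $f_0$ is Fréchet differentiable with $\nabla f_0$ Lipschitz continuous with modulus $M_{f_0}>0$. (A3) $\phi_1:Y\to\mathbb{R}$ is convex and Lipschitz continuous with modulus $M_{\phi_1}>0$. (A4) $f_1:X\to Y$, and there is an open set $V\supseteq\mathrm{dom}\,\phi_0$ on which $f_1$ is Fréchet differentiable with $f_1'$ Lipschitz continuous with modulus $M_{f_1}>0$. (A5) $J$ is bounded from below by some $\kappa_{\rm lb}\in\mathbb{R}$. Inexact trust-region algorithm. Inputs: $x_1\in\mathrm{dom}\,\phi_0$,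 $\Delta_1>0$, $0<\eta_1<\eta_2<1$, $0<\gamma_1\le\gamma_2<1\le\gamma_3$. Fixed constants independent of $k$: $\kappa_{\rm rad},\kappa_{\rm fcd},\kappa_{\rm grad},\kappa_{\rm val},\kappa_{\rm jac},\kappa_{\rm obj}>0$, $\zeta>1$, $0<\eta<\min\{\eta_1,1-\eta_2\}$, and positive reals $\zeta_k$ with $\zeta_k\to0$. For $k=1,2,\ldots$: (1) Choose $g_k\in X$, $b_k\in Y$, $A_k\in\mathcal{L}(X,Y)$, $B_k\in\mathcal{L}(X)$, $t_k>0$. Put $q_k(x)=\frac12(B_k(x-x_k),x-x_k)_X+(g_k,x-x_k)_X$, $\ell_k(x)=A_k(x-x_k)+b_k$, $\psi_k(x)=\phi_1(\ell_k(x))+\phi_0(x)$, $m_k=q_k+\psi_k$, and $h_k=\frac1{t_k}\|\mathrm{prox}_{t_k\psi_k}(x_k-t_kg_k)-x_k\|_X$. The choices must satisfy $\|g_k-\nabla f_0(x_k)\|_X\le\kappa_{\rm grad}\min\{h_k,\Delta_k\}$, $\|b_k-f_1(x_k)\|_Y\le\kappa_{\rm val}\min\{h_k,\Delta_k^2\}$, $\|A_k-f_1'(x_k)\|_{\mathcal{L}(X,Y)}\le\kappa_{\rm jac}\min\{h_k,\Delta_k\}$. (2) Compute a trial iterate $x_k^+\in X$ with $\|x_k^+-x_k\|_X\le\kappa_{\rm rad}\Delta_k$ and $m_k(x_k)-m_k(x_k^+)\ge\kappa_{\rm fcd}h_k\min\{h_k/(1+\|B_k\|_{\mathcal{L}(X)}),\Delta_k\}$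 (in particular $x_k^+\in\mathrm{dom}\,\phi_0$). (3) Let $\mathrm{ared}_k=J(x_k)-J(x_k^+)$, $\mathrm{pred}_k=m_k(x_k)-m_k(x_k^+)$, and let $\mathrm{cred}_k\in\mathbb{R}$ satisfy $|\mathrm{ared}_k-\mathrm{cred}_k|\le\kappa_{\rm obj}[\eta\min\{\mathrm{pred}_k,\zeta_k\}]^{\zeta}$. Set $\rho_k=\mathrm{cred}_k/\mathrm{pred}_k$. (4) If $\rho_k<\eta_1$: $x_{k+1}=x_k$ and $\Delta_{k+1}\in[\gamma_1\Delta_k,\gamma_2\Delta_k]$. Otherwise $x_{k+1}=x_k^+$, with $\Delta_{k+1}\in[\gamma_2\Delta_k,\Delta_k]$ if $\rho_k\in[\eta_1,\eta_2)$ and $\Delta_{k+1}\in[\Delta_k,\gamma_3\Delta_k]$ if $\rho_k\ge\eta_2$. The algorithm is understood to run indefinitely with all ratios $\rho_k$ well defined. Proximity operators are computed exactly. *)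

(* Defs.v *)
From HB Require Import structures.
From mathcomp Require Import all_boot all_order all_algebra.
From mathcomp Require Import all_classical all_reals all_analysis.

Set Implicit Arguments.
Unset Strict Implicit.
Unset Printing Implicit Defensive.

Import Order.TTheory GRing.Theory Num.Theory.
Import numFieldNormedType.Exports.

Local Open Scope classical_set_scope.
Local Open Scope ring_scope.

HB.mixin Record CompleteNormedModule_isHilbert (R : realType) T
    of CompleteNormedModule R T := {
  inner : {dot T for (@idfun R)} ;
  normr_inner : forall x : T, `|x| ^+ 2 = inner x x
}.

#[short(type="hilbertType")]
HB.structure Definition Hilbert (R : realType) :=
  {T of CompleteNormedModule R T & CompleteNormedModule_isHilbert R T}.

Section Operators.
Context {R : realType}.

(* The least bound of `|A x| over the unit ball; only meaningful for bounded A,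
   since sup is 0 on unbounded sets. *)
Definition opnorm {X Y : normedModType R} (A : X -> Y) : R :=
  sup [set `|A x| | x in [set x : X | `|x| <= 1]].

(* The element of X identified with the functional l; by the Riesz
   representation theorem it exists, and is unique, for l bounded linear. *)
Definition riesz {X : hilbertType R} (l : X -> R) : X :=
  xget 0 [set z | forall v, inner z v = l v].

Definition gradient {X : hilbertType R} (f : X -> R) (x : X) : X :=
  riesz ('d f x).

Definition adjoint {X Y : hilbertType R} (A : X -> Y) (y : Y) : X :=
  riesz (fun x => inner (A x) y).

End Operators.

Section ConvexAnalysis.
Context {R : realType} {X : hilbertType R}.
Implicit Types psi : X -> \bar R.
Local Open Scope ereal_scope.

Definition edom psi : set X := [set x | psi x < +oo].

Definition econvex psi := forall (x y : X) (s : R), (0 <= s <= 1)%R ->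
  psi (s *: x + (1 - s) *: y)%R <= s%:E * psi x + (1 - s)%:E * psi y.

Definition eproper psi := (forall x, psi x != -oo) /\ edom psi !=set0.

(* For eproper psi this is empty at points outside the domain of psi. *)
Definition subdifferential psi (x : X) : set X :=
  [set z | forall y, psi x + (inner z (y - x)%R)%:E <= psi y].

(* The argmin exists and is unique for psi proper, closed and convex. *)
Definition prox psi (x : X) : X :=
  xget 0%R [set p | forall y,
    (2^-1 * `|p - x| ^+ 2)%:E + psi p <= (2^-1 * `|y - x| ^+ 2)%:E + psi y].

End ConvexAnalysis.

Section Problem.
Context {R : realType} {X Y : hilbertType R}.

Record problem := Problem {
  f0 : X -> R ;
  f1 : X -> Y ;
  phi0 : X -> \bar R ;
  phi1 : Y -> R
}.

Definition objective (P : problem) (x : X) : \bar R :=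
  ((f0 P x)%:E + (phi1 P (f1 P x))%:E + phi0 P x)%E.

Record standing_assumptions (P : problem) (U V : set X)
    (Mf0 Mphi1 Mf1 klb : R) : Prop := StandingAssumptions {
  phi0_proper : eproper (phi0 P) ;
  phi0_closed : lower_semicontinuous (phi0 P) ;
  phi0_convex : econvex (phi0 P) ;
  U_open : open U ;
  dom_sub_U : edom (phi0 P) `<=` U ;
  f0_differentiable : forall x, U x -> differentiable (f0 P) x ;
  Mf0_gt0 : 0 < Mf0 ;
  f0_lipschitz : Mf0.-lipschitz_U (gradient (f0 P)) ;
  phi1_convex : convex_function [set: convex_lmodType Y] (phi1 P) ;
  Mphi1_gt0 : 0 < Mphi1 ;
  phi1_lipschitz : Mphi1.-lipschitz (phi1 P) ;
  V_open : open V ;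
  dom_sub_V : edom (phi0 P) `<=` V ;
  f1_differentiable : forall x, V x -> differentiable (f1 P) x ;
  Mf1_gt0 : 0 < Mf1 ;
  f1_lipschitz : forall x y, V x -> V y ->
    opnorm ('d (f1 P) x \- 'd (f1 P) y) <= Mf1 * `|x - y| ;
  objective_lb : forall x, (klb%:E <= objective P x)%E
}.

Definition stationary (P : problem) (x : X) : Prop :=
  exists2 theta, subdifferential (EFin \o phi1 P) (f1 P x) theta &
    subdifferential (phi0 P) x
      (- (gradient (f0 P) x + adjoint ('d (f1 P) x) theta)).

End Problem.
Arguments problem {R} X Y.

Section TrustRegion.
Context {R : realType} {X Y : hilbertType R}.

Record tr_constants := TRConstants {
  eta1 : R ; eta2 : R ;
  gamma1 : R ; gamma2 : R ; gamma3 : R ;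
  krad : R ; kfcd : R ; kgrad : R ; kval : R ; kjac : R ; kobj : R ;
  zeta : R ; eta_obj : R ;
  zeta_ : nat -> R
}.

Record tr_constants_valid (c : tr_constants) : Prop := TRConstantsValid {
  etas_bounds : [/\ 0 < eta1 c, eta1 c < eta2 c & eta2 c < 1] ;
  gammas_bounds :
    [/\ 0 < gamma1 c, gamma1 c <= gamma2 c, gamma2 c < 1 & 1 <= gamma3 c] ;
  krad_gt0 : 0 < krad c ;
  kfcd_gt0 : 0 < kfcd c ;
  kgrad_gt0 : 0 < kgrad c ;
  kval_gt0 : 0 < kval c ;
  kjac_gt0 : 0 < kjac c ;
  kobj_gt0 : 0 < kobj c ;
  zeta_gt1 : 1 < zeta c ;
  eta_obj_bounds : 0 < eta_obj c < Num.min (eta1 c) (1 - eta2 c) ;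
  zetak_gt0 : forall k, (0 < k)%N -> 0 < zeta_ c k ;
  zetak_cvg : zeta_ c @ \oo --> 0
}.

(* The quantities of iteration k = 1, 2, ...; the values at index 0 are
   irrelevant. *)
Record tr_run := TRRun {
  x_ : nat -> X ;
  Delta_ : nat -> R ;
  g_ : nat -> X ;
  b_ : nat -> Y ;
  A_ : nat -> {linear X -> Y} ;
  B_ : nat -> {linear X -> X} ;
  t_ : nat -> R ;
  xplus_ : nat -> X ;
  cred_ : nat -> R
}.

Variables (P : problem X Y) (c : tr_constants) (r : tr_run).
Implicit Type k : nat.

Definition quad_model k (x : X) : R :=
  2^-1 * inner (B_ r k (x - x_ r k)) (x - x_ r k)
  + inner (g_ r k) (x - x_ r k).

Definition lin_model k (x : X) : Y := A_ r k (x - x_ r k) + b_ r k.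

Definition psi_model k (x : X) : \bar R :=
  ((phi1 P (lin_model k x))%:E + phi0 P x)%E.

Definition model k (x : X) : \bar R := ((quad_model k x)%:E + psi_model k x)%E.

Definition hmeas k : R :=
  (t_ r k)^-1 *
  `|prox (fun x => (t_ r k)%:E * psi_model k x)%E
      (x_ r k - t_ r k *: g_ r k) - x_ r k|.

Definition ared k : \bar R :=
  (objective P (x_ r k) - objective P (xplus_ r k))%E.

Definition predred k : \bar R := (model k (x_ r k) - model k (xplus_ r k))%E.

Definition rho k : R := cred_ r k / fine (predred k).

(* In model_decrease the reduction of the model is compared in the extended
   reals: as it is bounded below by a real, the trial point is in the domain of
   phi0, so that the predicted and actual reductions are finite. *)
Record tr_iteration k : Prop := TRIteration {
  A_bounded : continuous (A_ r k) ;
  B_bounded : continuous (B_ r k) ;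
  t_gt0 : 0 < t_ r k ;
  grad_error : `|g_ r k - gradient (f0 P) (x_ r k)|
    <= kgrad c * Num.min (hmeas k) (Delta_ r k) ;
  val_error : `|b_ r k - f1 P (x_ r k)|
    <= kval c * Num.min (hmeas k) (Delta_ r k ^+ 2) ;
  jac_error : opnorm (A_ r k \- 'd (f1 P) (x_ r k))
    <= kjac c * Num.min (hmeas k) (Delta_ r k) ;
  trial_radius : `|xplus_ r k - x_ r k| <= krad c * Delta_ r k ;
  model_decrease : ((kfcd c * hmeas k *
      Num.min (hmeas k / (1 + opnorm (B_ r k))) (Delta_ r k))%:E
    <= predred k)%E ;
  cred_error : (`|ared k - (cred_ r k)%:E| <=
    (kobj c *
      (eta_obj c * Num.min (fine (predred k)) (zeta_ c k)) `^ zeta c)%:E)%E ;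
  rho_defined : fine (predred k) != 0 ;
  update_reject : rho k < eta1 c -> x_ r k.+1 = x_ r k /\
    gamma1 c * Delta_ r k <= Delta_ r k.+1 <= gamma2 c * Delta_ r k ;
  update_accept : eta1 c <= rho k -> x_ r k.+1 = xplus_ r k ;
  radius_shrink : eta1 c <= rho k < eta2 c ->
    gamma2 c * Delta_ r k <= Delta_ r k.+1 <= Delta_ r k ;
  radius_expand : eta2 c <= rho k ->
    Delta_ r k <= Delta_ r k.+1 <= gamma3 c * Delta_ r k
}.

Record tr_generated : Prop := TRGenerated {
  constants_valid : tr_constants_valid c ;
  init_dom : edom (phi0 P) (x_ r 1) ;
  init_radius : 0 < Delta_ r 1 ;
  iteration : forall k, (0 < k)%N -> tr_iteration k
}.

End TrustRegion.
Arguments tr_constants : clear implicits.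
Arguments tr_run {R} X Y.

(* Main.v *)
Require Import Defs.
From mathcomp Require Import all_boot all_order all_algebra.
From mathcomp Require Import all_classical all_reals all_analysis.
From mathcomp Require Import ring lra.

Set Implicit Arguments.
Unset Strict Implicit.
Unset Printing Implicit Defensive.

Import Order.TTheory GRing.Theory Num.Theory.
Import numFieldNormedType.Exports.

Local Open Scope classical_set_scope.
Local Open Scope ring_scope.

(** At the proximal point p_k = prox_(t_k psi_k)(x_k - t_k g_k) the residual
    s_k = (x_k - p_k) / t_k has norm h_k and satisfies
    s_k - g_k \in d psi_k(p_k), that is, for every w,
      phi1 (l_k p_k) + phi0 p_k + <s_k - g_k, w - p_k>
        <= phi1 (l_k w) + phi0 w
    ([prox_step]).  Along K, h_k tends to 0, hence s_k tends to 0; as t_k is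
    bounded, |x_k - p_k| = t_k h_k tends to 0 and p_k tends to xbar.  The three
    accuracy conditions are all relative to h_k, so g_k, b_k and A_k tend to the
    gradient of f0, to f1 and to f1' at xbar.  The inequality therefore passes
    to the limit, the lower semicontinuity of phi0 taking care of phi0 p_k
    ([composite_optimality_limit]): the point xbar minimizes
      w |-> <grad f0 xbar, w> + phi1 (f1 xbar + f1' xbar (w - xbar)) + phi0 w.

    It remains to split this optimality condition into a subgradient theta of
    phi1 and one of phi0, which is a Moreau-Rockafellar theorem
    ([subdifferential_chain]).  Let
      q v = inf_w phi1 (f1 xbar + v + f1' xbar (w - xbar)) + phi0 w
                  + <grad f0 xbar, w - xbar>.
    It is finite because xbar is optimal for v = 0 and phi1 is Lipschitz, and it
    is convex and Lipschitz in turn.  Any subgradient theta of q at 0 does both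
    jobs: keeping w = xbar shows that it is a subgradient of phi1, and choosing
    v = - f1' xbar (w - xbar) gives the inclusion for phi0.

    That a Lipschitz convex function has a subgradient at every point
    ([lipschitz_convex_subdifferential]) is obtained by Moreau-Yosida
    regularization: the residuals (z - prox_(lam F) z) / lam are subgradients of
    F at points tending to z, and as lam decreases to 0 they converge strongly,
    as their norms are bounded and increase.  The Riesz representation
    ([riesz_inner]), which gives its meaning to the adjoint of f1' xbar, is the
    case of a bounded linear functional.  All this, like the description of h_k
    itself, rests on the existence of the proximal point of a proper closed
    convex function ([prox_exists]). *)

(** * Inner products *)

Section InnerProduct.
Context {R : realType} {X : hilbertType R}.
Implicit Types (u v w : X) (a : R).

Lemma innerC u v : inner u v = inner v u.
Proof. by rewrite hermC /= expr0 mul1r. Qed.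

Lemma innerDl u v w : inner (u + v) w = inner u w + inner v w.
Proof. by rewrite linearDl. Qed.

Lemma innerNl u v : inner (- u) v = - inner u v.
Proof. by rewrite linearNl. Qed.

Lemma innerZl a u v : inner (a *: u) v = a * inner u v.
Proof. by rewrite linearZl_LR. Qed.

Lemma innerDr u v w : inner u (v + w) = inner u v + inner u w.
Proof. by rewrite !(innerC u) innerDl. Qed.

Lemma innerNr u v : inner u (- v) = - inner u v.
Proof. by rewrite !(innerC u) innerNl. Qed.

Lemma innerZr a u v : inner u (a *: v) = a * inner u v.
Proof. by rewrite !(innerC u) innerZl. Qed.

Lemma inner0r u : inner u 0 = 0.
Proof. by rewrite -(scale0r 0) innerZr mul0r. Qed.

Definition innerE := (innerDl, innerDr, innerNl, innerNr, innerZl, innerZr).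

Lemma sqr_normD u v : `|u + v| ^+ 2 = `|u| ^+ 2 + 2 * inner u v + `|v| ^+ 2.
Proof. by rewrite !normr_inner !innerE (innerC v u); ring. Qed.

Lemma sqr_normZ a u : `|a *: u| ^+ 2 = a ^+ 2 * `|u| ^+ 2.
Proof. by rewrite !normr_inner !innerE; ring. Qed.

Lemma inner_polarization u v :
  inner u v = 2^-1 * (`|u + v| ^+ 2 - `|u| ^+ 2 - `|v| ^+ 2).
Proof. by rewrite sqr_normD; lra. Qed.

Lemma inner_le_norm u v : inner u v <= `|u| * `|v|.
Proof.
have [u0|u0] := eqVneq u 0.
  by rewrite innerC u0 inner0r mulr_ge0.
have [v0|v0] := eqVneq v 0.
  by rewrite v0 inner0r mulr_ge0.
have uv_gt0 : 0 < `|u| * `|v| by rewrite mulr_gt0 ?normr_gt0.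
have := sqr_ge0 `| `|v| *: u + - `|u| *: v|.
rewrite sqr_normD !sqr_normZ !innerE => h.
by rewrite -(ler_pM2l uv_gt0); nra.
Qed.

Lemma cvg_inner (T : Type) (F : set_system T) {FF : Filter F}
    (f g : T -> X) u v :
  f @ F --> u -> g @ F --> v -> (fun x => inner (f x) (g x)) @ F --> inner u v.
Proof.
move=> fu gv; rewrite inner_polarization.
under eq_fun do rewrite inner_polarization.
have cvg_sqr (h : T -> X) w : h @ F --> w ->
    (fun x => `|h x| ^+ 2) @ F --> `|w| ^+ 2.
  by move=> hw; rewrite expr2; apply: cvgM; apply: cvg_norm.
apply: cvgM; first exact: cvg_cst.
apply: cvgB; last exact: cvg_sqr.
by apply: cvgB; apply: cvg_sqr => //; apply: cvgD.
Qed.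

End InnerProduct.

(** * Existence of proximal points *)

(** Two sequences below, a minimizing one and a sequence of Yosida residuals,
    converge for the same reason: their squared distances are controlled by a
    convergent real sequence. *)
Lemma cvgn_sqr_dist {R : realType} {V : completeNormedModType R}
    (u : nat -> V) (f : nat -> R) (m C : R) :
    f @ \oo --> m -> 0 < C ->
    (forall i j, `|u i - u j| ^+ 2 <= C * (`|f i - m| + `|f j - m|)) ->
  cvgn u.
Proof.
move=> fm C0 hu; apply/cauchy_cvgP/cauchy_exP => e e0.
have d0 : 0 < (2 * C)^-1 * e ^+ 2.
  by rewrite mulr_gt0 ?exprn_gt0 ?invr_gt0 ?mulr_gt0.
have /cvgrPdistC_lt /(_ _ d0)[N _ hN] := fm.
exists (u N), N => // j Nj; rewrite -ball_normE /=.
rewrite -(ltr_pXn2r (n := 2)) ?nnegrE ?(ltW e0)//.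
apply: le_lt_trans (hu N j) _.
have -> : e ^+ 2 = C * ((2 * C)^-1 * e ^+ 2 + (2 * C)^-1 * e ^+ 2).
  by field; rewrite gt_eqF.
by rewrite ltr_pM2l// ltrD// hN//=.
Qed.

Section ProperConvex.
Context {R : realType} {X : hilbertType R}.
Implicit Types (psi : X -> \bar R) (x y z : X) (s : R).

Lemma edom_fineK psi x : eproper psi -> edom psi x -> psi x = (fine (psi x))%:E.
Proof.
move=> [psiN _] dx; rewrite fineK// fin_numElt dx andbT.
by rewrite ltNye psiN.
Qed.

Lemma econvex_edom psi x y s : eproper psi -> econvex psi ->
  edom psi x -> edom psi y -> 0 <= s <= 1 ->
  edom psi (s *: x + (1 - s) *: y) /\
  fine (psi (s *: x + (1 - s) *: y))
    <= s * fine (psi x) + (1 - s) * fine (psi y).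
Proof.
move=> pp cp dx dy s01; have := cp x y s s01.
rewrite (edom_fineK pp dx) (edom_fineK pp dy) -!EFinM -EFinD => h.
have dw : edom psi (s *: x + (1 - s) *: y) by apply: le_lt_trans h (ltry _).
by split => //; move: h; rewrite (edom_fineK pp dw) lee_fin.
Qed.

(** Lower semicontinuity bounds psi from below by psi x - 1 on a ball of radius
    r around a point x of the domain.  For y farther away, the point of the
    segment from x to y at distance r / 2 from x is in that ball, and convexity
    on the segment keeps psi from decreasing faster than linearly.  Such a
    minorant is enough to bound psi plus a quadratic from below. *)
Lemma lsc_convex_cone_minorant psi :
    eproper psi -> lower_semicontinuous psi -> econvex psi ->
  exists x a b, 0 < b /\
    forall y, edom psi y -> a - b * `|y - x| <= fine (psi y).
Proof.
move=> pp lp cp; have [_ [x dx]] := pp.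
have /lp[V xV psiV] : ((fine (psi x) - 1)%:E < psi x)%E.
  by rewrite [ltRHS](edom_fineK pp dx) lte_fin gtrBl.
have [r r0 rV] : exists2 r : R, 0 < r & ball x r `<=` V.
  by move/nbhs_ballP : xV => [r /= r0 rV]; exists r.
exists x, (fine (psi x) - 1), (2 / r); split; first by rewrite divr_gt0.
move=> y dy; have r2 : 0 < 2 / r by rewrite divr_gt0.
have [yr|yr] := ltP `|y - x| r.
  have : ((fine (psi x) - 1)%:E < psi y)%E.
    by apply: psiV; apply: rV; rewrite -ball_normE /= distrC.
  rewrite (edom_fineK pp dy) lte_fin => /ltW; apply: le_trans.
  by rewrite gerBl mulr_ge0 ?(ltW r2).
set d := `|y - x| in yr *.
have d0 : 0 < d by apply: lt_le_trans yr.
pose s : R := r / (2 * d).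
have s0 : 0 < s by rewrite divr_gt0// mulr_gt0.
have s1 : s <= 1.
  by rewrite ler_pdivrMr ?mulr_gt0// mul1r; lra.
have s01 : 0 <= s <= 1 by rewrite (ltW s0).
have [dw hw] := econvex_edom pp cp dy dx s01.
have : ((fine (psi x) - 1)%:E < psi (s *: y + (1 - s) *: x)%R)%E.
  apply: psiV; apply: rV; rewrite -ball_normE /= distrC.
  have -> : s *: y + (1 - s) *: x - x = s *: (y - x).
    by rewrite scalerBl scale1r scalerBr [x - _]addrC addrA addrK.
  rewrite normrZ gtr0_norm// -/d /s.
  have -> : r / (2 * d) * d = r / 2 by field; rewrite gt_eqF.
  by lra.
rewrite (edom_fineK pp dw) lte_fin => {}hw'.
have {hw hw'} : - 1 < s * (fine (psi y) - fine (psi x)) by lra.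
have -> : 2 / r * d = s^-1 by rewrite /s; field; rewrite !gt_eqF.
rewrite -ltr_pdivrMl// mulrN1 => h; lra.
Qed.

(** Strong convexity of the proximal objective, at midpoints: the parallelogram
    identity makes the objective at the midpoint smaller than the average by
    an eighth of the squared distance. *)
Lemma convex_midpoint_gap psi z x y : eproper psi -> econvex psi ->
    edom psi x -> edom psi y ->
  exists2 w, edom psi w &
    2^-1 * `|w - z| ^+ 2 + fine (psi w) + 8^-1 * `|x - y| ^+ 2 <=
    2^-1 * (2^-1 * `|x - z| ^+ 2 + fine (psi x)) +
    2^-1 * (2^-1 * `|y - z| ^+ 2 + fine (psi y)).
Proof.
move=> pp cp dx dy; have h01 : 0 <= (2^-1 : R) <= 1 by apply/andP; split; lra.
have [dw hw] := econvex_edom pp cp dx dy h01.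
exists (2^-1 *: x + (1 - 2^-1) *: y) => //.
have half : 1 - 2^-1 = 2^-1 :> R by lra.
rewrite half in hw *.
have -> : 2^-1 *: x + 2^-1 *: y - z = 2^-1 *: ((x - z) + (y - z)).
  rewrite addrACA -opprD !scalerDr scalerN; congr (_ - _).
  by rewrite scalerDr -scalerDl -{2}half addrC subrK scale1r.
have -> : x - y = (x - z) + - (y - z) by rewrite opprB addrA subrK.
move: (x - z) (y - z) => a b; rewrite sqr_normZ !sqr_normD innerNr normrN; lra.
Qed.

(** A minimizing sequence is Cauchy because the midpoints of its terms cannot do
    better than the infimum; lower semicontinuity makes its limit a
    minimizer. *)
Lemma prox_exists psi z :
    eproper psi -> lower_semicontinuous psi -> econvex psi ->
  exists p, forall y, ((2^-1 * `|p - z| ^+ 2)%:E + psi p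
                       <= (2^-1 * `|y - z| ^+ 2)%:E + psi y)%E.
Proof.
move=> pp lp cp.
pose f y := 2^-1 * `|y - z| ^+ 2 + fine (psi y).
have [x0 [a [b [b0 minor]]]] := lsc_convex_cone_minorant pp lp cp.
have [_ [d0 dd0]] := pp.
pose S := [set f y | y in edom psi].
have S0 : S !=set0 by exists (f d0); exists d0.
have lbS : has_lbound S.
  (* The term b^2 / 2 absorbs b |y - z| - |y - z|^2 / 2. *)
  exists (a - b * `|z - x0| - 2^-1 * b ^+ 2) => _ [y dy <-].
  apply: le_trans (lerD (lexx _) (minor y dy)).
  have : `|y - x0| <= `|y - z| + `|z - x0|.
    by rewrite -(subrKA z) ler_normD.
  move=> /(ler_wpM2l (ltW b0)).
  have := sqr_ge0 (`|y - z| - b); nra.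
have infS : has_inf S by [].
pose m := inf S.
have mle y : edom psi y -> m <= f y by move=> dy; apply: ge_inf => //; exists y.
have /choice[u hu] : forall n : nat, exists y,
    edom psi y /\ f y < m + n.+1%:R^-1.
  move=> n; have n0 : 0 < n.+1%:R^-1 :> R by [].
  by have [_ [y dy <-] ?] := inf_adherent n0 infS; exists y.
have fu : f \o u @ \oo --> m.
  apply: (@squeeze_cvgr _ _ _ _ (cst m) (fun n => m + n.+1%:R^-1)).
  - by apply: nearW => n /=; have [du /ltW->] := hu n; rewrite mle.
  - exact: cvg_cst.
  - by rewrite -[X in _ --> X]addr0; apply: cvgD;
      [exact: cvg_cst|exact: cvg_harmonic].
have /cvg_ex[p up] : cvgn u.
  apply: (@cvgn_sqr_dist _ _ u (f \o u) m 4) => // i j /=.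
  have [w dw] := convex_midpoint_gap z pp cp (hu i).1 (hu j).1 => gap.
  rewrite !ger0_norm ?subr_ge0 ?mle//; [|exact: (hu _).1..].
  have := mle _ dw; rewrite /f; move: gap; lra.
have nup : (fun n => 2^-1 * `|u n - z| ^+ 2) @ \oo --> 2^-1 * `|p - z| ^+ 2.
  apply: cvgM; first exact: cvg_cst.
  have up' : (fun n => `|u n - z|) @ \oo --> `|p - z|.
    by apply: cvg_norm; exact: (cvgB up (cvg_cst z)).
  by rewrite expr2; apply: cvgM.
have key (c : R) : (c%:E < psi p)%E -> 2^-1 * `|p - z| ^+ 2 + c <= m.
  move=> /(lp p)[V pV hV].
  apply: (ler_cvg_to (cvgD nup (cvg_cst c)) fu).
  near=> n; rewrite /= lerD2l.
  have : (c%:E < psi (u n))%E by apply: hV; near: n; exact: up.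
  by rewrite (edom_fineK pp (hu n).1) lte_fin => /ltW.
have dp : edom psi p.
  rewrite /edom /= ltey; apply/eqP => pE.
  have := key (m - 2^-1 * `|p - z| ^+ 2 + 1).
  by rewrite pE ltry => /(_ isT); lra.
have fp : f p <= m.
  rewrite /f; apply/ler_addgt0Pl => e e0; rewrite -lerBlDl -addrA.
  by apply: key; rewrite [ltRHS](edom_fineK pp dp) lte_fin; lra.
exists p => y; have [dy|] := pselect (edom psi y).
  rewrite (edom_fineK pp dp) (edom_fineK pp dy) -!EFinD lee_fin.
  exact: le_trans fp (mle _ dy).
rewrite /edom /= ltey => /negP; rewrite negbK => /eqP->.
by rewrite addey// leey.
Unshelve. all: by end_near. Qed.

End ProperConvex.

(** * Stability of proper closed convex functions *)

Section ConvexBuilders.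
Context {R : realType}.

Lemma convex_functionTP {E : lmodType R} (F : E -> R) :
  convex_function [set: convex_lmodType E] F <->
  forall (x y : E) (s : R), 0 <= s <= 1 ->
    F (s *: x + (1 - s) *: y) <= s * F x + (1 - s) * F y.
Proof.
split=> [cF x y s s01|cF t x y _ _].
  have /= := cF (Itv01 (proj1 (andP s01)) (proj2 (andP s01))) x y.
  by rewrite !inE; apply.
by apply: cF; rewrite ge0 le1.
Qed.

Context {X : hilbertType R}.
Implicit Types (psi : X -> \bar R) (F : X -> R) (t : R).

Lemma lipschitz_continuous_fun {V W : normedModType R} (F : V -> W) (M : R) :
  (forall x y, `|F x - F y| <= M * `|x - y|) -> continuous F.
Proof.
move=> lF x; apply/cvgrPdist_le => e e0; near=> y.
have M1 : 0 < `|M| + 1 by rewrite ltr_wpDl.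
apply: le_trans (lF _ _) _.
apply: (@le_trans _ _ ((`|M| + 1) * `|x - y|)).
  by rewrite ler_wpM2r// (le_trans (ler_norm M))// lerDl.
rewrite -ler_pdivlMl//; near: y; apply: cvgr_dist_le; first exact: cvg_id.
by rewrite mulr_gt0// invr_gt0.
Unshelve. all: by end_near. Qed.

Lemma lsc_addl F psi : continuous F -> lower_semicontinuous psi ->
  lower_semicontinuous (fun x => (F x)%:E + psi x)%E.
Proof.
move=> cF lpsi x a axp.
have [c [cp ac]] : exists c, (c%:E < psi x)%E /\ a - F x < c.
  case E: (psi x) axp => [r| |//].
    rewrite lte_fin => axr; exists (2^-1 * (a - F x + r)); rewrite lte_fin.
    by split; lra.
  by move=> _; exists (a - F x + 1); rewrite ltry ltrDl.
have [V xV hV] := lpsi _ _ cp.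
exists (V `&` [set y | a - c < F y]).
  apply: filterI => //; apply: (cvgr_gt (F x)); first exact: cF.
  by rewrite ltrBlDr addrC -ltrBlDr.
move=> y [/hV cy /= Fy]; apply: (@le_lt_trans _ _ ((F y)%:E + c%:E)%E).
  by rewrite lee_fin; lra.
by rewrite lteD2lE.
Qed.

Lemma eproper_addl F psi : eproper psi -> eproper (fun x => (F x)%:E + psi x)%E.
Proof.
move=> [pN [d dd]]; split => [x|]; last first.
  by exists d; rewrite /edom /= lte_add_pinfty// ltry.
by have := pN x; case: (psi x).
Qed.

Lemma econvex_addl F psi : eproper psi ->
    (forall x y s, 0 <= s <= 1 ->
      F (s *: x + (1 - s) *: y) <= s * F x + (1 - s) * F y) ->
  econvex psi -> econvex (fun x => (F x)%:E + psi x)%E.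
Proof.
move=> pp cF cpsi x y s s01.
rewrite !muleDr ?fin_num_adde_defr// -!EFinM addeACA -EFinD.
by apply: leeD; [rewrite lee_fin cF|exact: cpsi].
Qed.

Lemma eproper_scale t psi : 0 < t -> eproper psi ->
  eproper (fun x => t%:E * psi x)%E.
Proof.
move=> t0 pp; have [pN [d dd]] := pp; split => [x|].
  have := pN x; case: (psi x) => [r| |//] _ //.
  by rewrite mulry gtr0_sg// mul1e.
by exists d; rewrite /edom /= (edom_fineK pp dd) -EFinM ltry.
Qed.

Lemma lsc_scale t psi : 0 < t -> lower_semicontinuous psi ->
  lower_semicontinuous (fun x => t%:E * psi x)%E.
Proof.
move=> t0 lp x a.
have aE : a%:E = (t%:E * (t^-1 * a)%:E)%E.
  by rewrite -EFinM mulrA divff ?mul1r// gt_eqF.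
rewrite aE lte_pmul2l// => /lp[V xV hV].
by exists V => // y /hV; rewrite lte_pmul2l.
Qed.

Lemma econvex_scale t psi : 0 < t -> eproper psi -> econvex psi ->
  econvex (fun x => t%:E * psi x)%E.
Proof.
move=> t0 pp cp x y s s01.
rewrite muleCA [X in (_ <= _ + X)%E]muleCA -muleDr//.
  by rewrite lee_pmul2l//; exact: cp.
have [pN _] := pp; have := pN x; have := pN y; case/andP: s01 => s0 s1.
have psE z r : 0 <= r -> (r%:E * psi z != -oo)%E.
  rewrite le_eqVlt => /predU1P[<-|r0]; first by rewrite mul0e.
  have := pN z; case: (psi z) => // _; by rewrite mulry gtr0_sg// mul1e.
by move=> _ _; rewrite ltninfty_adde_def// inE ltNye psE// subr_ge0.
Qed.

End ConvexBuilders.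

(** * Proximal points and subgradients *)

Section Subdifferential.
Context {R : realType} {X : hilbertType R}.
Implicit Types (psi : X -> \bar R) (x y z v p : X) (t : R).

Lemma subdifferential_edom psi x v :
  eproper psi -> subdifferential psi x v -> edom psi x.
Proof.
move=> [pN [d dd]] /(_ d); rewrite /edom /= in dd *.
by have := pN x; case: (psi x) => [r| |//] _; rewrite ?ltry// leNgt dd.
Qed.

Lemma subdifferential_scale t psi x v : 0 < t ->
  subdifferential (fun y => t%:E * psi y)%E x (t *: v) <->
  subdifferential psi x v.
Proof.
move=> t0; split => h y; have := h y;
  by rewrite innerZl EFinM -muleDr ?fin_num_adde_defl// lee_pmul2l.
Qed.

(** Fermat's rule: moving from p towards y by a fraction s changes the quadratic
    term by s <p - z, y - p> up to an error of order s^2, and psi by at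
    most s (psi y - psi p); divide by s and let s tend to 0. *)
Lemma argmin_subdifferential psi z p : eproper psi -> econvex psi ->
    (forall y, ((2^-1 * `|p - z| ^+ 2)%:E + psi p
                <= (2^-1 * `|y - z| ^+ 2)%:E + psi y)%E) ->
  subdifferential psi p (z - p).
Proof.
move=> pp cp hp; have [pN [d dd]] := pp.
have dp : edom psi p.
  have := hp d; rewrite (edom_fineK pp dd) -EFinD /edom /=.
  by have := pN p; case: (psi p) => // r _ _; rewrite ltry.
move=> y; have [dy|] := pselect (edom psi y); last first.
  by rewrite /edom /= ltey => /negP; rewrite negbK => /eqP->; rewrite leey.
rewrite (edom_fineK pp dp) (edom_fineK pp dy) -EFinD lee_fin.
set D := fine (psi p) + inner (z - p) (y - p) - fine (psi y).
have small s : 0 < s <= 1 -> D <= s * (2^-1 * `|y - p| ^+ 2).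
  move=> /andP[s0 s1]; have s01 : 0 <= s <= 1 by rewrite (ltW s0).
  have [dw hw] := econvex_edom pp cp dy dp s01.
  have := hp (s *: y + (1 - s) *: p).
  rewrite (edom_fineK pp dp) (edom_fineK pp dw) -!EFinD lee_fin.
  have -> : s *: y + (1 - s) *: p - z = s *: (y - p) + - (z - p).
    by rewrite scalerBl scale1r scalerBr opprB [p - _]addrC !addrA.
  rewrite (sqr_normD (s *: _)) sqr_normZ normrN innerZl innerNr innerC.
  rewrite (distrC z p) => h.
  by rewrite -(ler_pM2l s0) /D; nra.
rewrite -subr_le0 -/D; apply/ler_addgt0Pl => e e0; rewrite addr0.
set c := 2^-1 * `|y - p| ^+ 2 in small.
have c0 : 0 <= c by rewrite mulr_ge0 ?sqr_ge0 ?invr_ge0.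
(* This s lies in ]0, 1], even when c = 0, and makes s c at most e. *)
pose s := e / (e + c).
have ec0 : 0 < e + c by rewrite ltr_wpDr.
apply: le_trans (small s _) _.
  by rewrite divr_gt0// ler_pdivrMr// mul1r lerDl.
by rewrite /s mulrAC ler_pdivrMr// ler_pM2l// lerDr ltW.
Qed.

Lemma prox_subdifferential psi z :
    eproper psi -> lower_semicontinuous psi -> econvex psi ->
  subdifferential psi (prox psi z) (z - prox psi z).
Proof.
move=> pp lp cp; apply: argmin_subdifferential => //.
exact: (xgetPex 0 (prox_exists z pp lp cp)).
Qed.

(** Adding half the squared distance to x + v turns the subgradient inequality
    at x into a quadratic growth condition, so that x is the only minimizer;
    uniqueness matters since prox is defined by a choice. *)
Lemma subdifferential_prox psi x v :
  eproper psi -> subdifferential psi x v -> prox psi (x + v) = x.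
Proof.
move=> pp xv; have dx := subdifferential_edom pp xv.
have gap y : edom psi y ->
    2^-1 * `|x - (x + v)| ^+ 2 + fine (psi x) + 2^-1 * `|y - x| ^+ 2
    <= 2^-1 * `|y - (x + v)| ^+ 2 + fine (psi y).
  move=> dy; have := xv y.
  rewrite (edom_fineK pp dx) (edom_fineK pp dy) -EFinD lee_fin.
  rewrite opprD !addrA subrr sub0r normrN (sqr_normD (y - x)).
  rewrite normrN innerNr innerC; lra.
have xmin : [set p | forall y, ((2^-1 * `|p - (x + v)| ^+ 2)%:E + psi p <=
    (2^-1 * `|y - (x + v)| ^+ 2)%:E + psi y)%E] x.
  move=> y; have [dy|] := pselect (edom psi y); last first.
    by rewrite /edom /= ltey => /negP; rewrite negbK => /eqP->;
       rewrite addey// leey.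
  rewrite (edom_fineK pp dx) (edom_fineK pp dy) -!EFinD lee_fin.
  apply: le_trans (gap y dy); rewrite lerDl mulr_ge0 ?sqr_ge0// invr_ge0//.
apply: xget_unique => // p pmin; have := pmin x.
have dp : edom psi p.
  move: (pmin x); rewrite (edom_fineK pp dx) -EFinD /edom /=.
  by have [pN _] := pp; have := pN p; case: (psi p) => // r _ _; rewrite ltry.
rewrite (edom_fineK pp dx) (edom_fineK pp dp) -!EFinD lee_fin => h.
have := gap p dp => h2; apply/eqP; rewrite -subr_eq0 -normr_eq0 -sqrf_eq0.
by rewrite eq_le sqr_ge0 andbT; lra.
Qed.

End Subdifferential.

(** * Subgradients of Lipschitz convex functions *)

Section LipschitzConvex.
Context {R : realType} {X : hilbertType R}.

(** The Yosida residual of F at z is a subgradient of F at the proximal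
    point. *)
Lemma lipschitz_convex_prox (F : X -> R) (M t : R) (z : X) :
    convex_function [set: convex_lmodType X] F ->
    (forall x y, `|F x - F y| <= M * `|x - y|) -> 0 < t ->
  let p := prox (fun x => t%:E * (EFin \o F) x)%E z in
  forall y, F p + inner (t^-1 *: (z - p)) (y - p) <= F y.
Proof.
move=> cF lF t0 p y.
have pF : eproper (EFin \o F) by split => //; exists 0; rewrite /edom /= ltry.
have lscF : lower_semicontinuous (EFin \o F).
  have lsc0 : lower_semicontinuous (fun _ : X => 0 : \bar R).
    by move=> x a a0; exists setT => //; exact: filterT.
  move=> x a; rewrite -[(EFin \o F) x]adde0.
  move=> /(lsc_addl (lipschitz_continuous_fun lF) lsc0)[V xV hV].
  by exists V => // w /hV; rewrite adde0.
have ceF : econvex (EFin \o F).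
  by move=> x w s s01; rewrite lee_fin; move/convex_functionTP : cF; apply.
have /(_ y) := prox_subdifferential z (eproper_scale t0 pF)
  (lsc_scale t0 lscF) (econvex_scale t0 pF ceF).
rewrite -/p /= -!EFinM -EFinD lee_fin innerZl => h.
by rewrite -(ler_pM2l t0) mulrDr mulrA divff ?mul1r// gt_eqF.
Qed.

(** Monotonicity of the subdifferential, applied to the residuals th_i and th_j
    of parameters lam_j < lam_i, gives |th_i - th_j|^2 <= |th_j|^2 - |th_i|^2.
    Hence the norms increase, and being bounded by the Lipschitz constant they
    converge, which makes the residuals themselves converge. *)
Lemma lipschitz_convex_subdifferential (F : X -> R) (M : R) (z : X) :
    convex_function [set: convex_lmodType X] F ->
    0 <= M -> (forall x y, `|F x - F y| <= M * `|x - y|) ->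
  exists v, subdifferential (EFin \o F) z v.
Proof.
move=> cF M0 lF.
pose lam n : R := n.+1%:R^-1.
have lam0 n : 0 < lam n by rewrite invr_gt0.
pose p n := prox (fun x => (lam n)%:E * (EFin \o F) x)%E z.
pose th n := (lam n)^-1 *: (z - p n).
have sub n y : F (p n) + inner (th n) (y - p n) <= F y.
  exact: lipschitz_convex_prox cF lF (lam0 n) y.
have pE n : p n = z - lam n *: th n.
  by rewrite /th scalerA divff ?gt_eqF// scale1r subKr.
have thM n : `|th n| <= M.
  have := sub n (p n + th n); rewrite [p n + _]addrC addrK -normr_inner => h.
  have := le_trans (ler_norm _) (lF (p n + th n) (p n)).
  rewrite [p n + _]addrC addrK => h2.
  have [->|th0] := eqVneq (th n) 0; first by rewrite normr0.
  rewrite -(@ler_pM2r _ `|th n|) ?normr_gt0//; move: h; lra.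
(* With its body visible, th would be unfolded when inner products expand. *)
clearbody th; pose b n := `|th n| ^+ 2.
have mono i j : (i < j)%N -> `|th i - th j| ^+ 2 <= b j - b i.
  move=> ij; have lij : lam j < lam i by rewrite ltf_pV2 ?posrE// ltr_nat.
  have := sub i (p j); have := sub j (p i).
  have -> : p j - p i = lam i *: th i - lam j *: th j.
    by rewrite !pE opprB addrC addrA subrK.
  have -> : p i - p j = lam j *: th j - lam i *: th i.
    by rewrite !pE opprB addrC addrA subrK.
  rewrite !innerE -!normr_inner (innerC (th j)) -!/(b _) => h1 h2.
  have D0 : 0 <= `|th i - th j| ^+ 2 by rewrite sqr_ge0.
  have DE : `|th i - th j| ^+ 2 = b i - 2 * inner (th i) (th j) + b j.
    by rewrite sqr_normD normrN innerNr /b; ring.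
  have := lam0 j; have := lam0 i; move: D0 h1 h2 lij.
  rewrite DE; move: (lam i) (lam j) (b i) (b j) (inner _ _) => x y bi bj c.
  move=> D0 h1 h2 yx x0 y0.
  have h3 : (x + y) * (bi - 2 * c + bj) <= (x - y) * (bj - bi) by nra.
  have h4 : 0 <= bj - bi.
    rewrite -(@pmulr_rge0 _ (x - y)) ?subr_gt0//; apply: le_trans h3.
    by rewrite mulr_ge0// addr_ge0// ltW.
  rewrite -(ler_pM2l (addr_gt0 x0 y0)); apply: le_trans h3 _.
  by rewrite ler_wpM2r//; lra.
have bnd : cvgn b.
  apply: nondecreasing_is_cvgn.
    apply/nondecreasing_seqP => n; rewrite -subr_ge0.
    by apply: le_trans (mono n n.+1 (ltnSn n)); exact: sqr_ge0.
  exists (M ^+ 2) => _ [n _ <-].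
  by rewrite ler_pXn2r ?nnegrE.
have /cvg_ex[v thv] : cvgn th.
  apply: (@cvgn_sqr_dist _ _ th b (limn b) 1) => // i j.
  have tri (x y l : R) : x - y <= `|y - l| + `|x - l|.
    by have := ler_norm (x - l); have := ler_norm (- (y - l));
      rewrite normrN; lra.
  rewrite mul1r; have [ij|ji|ij] := ltngtP i j.
  - exact: le_trans (mono _ _ ij) (tri _ _ _).
  - by rewrite distrC [leRHS]addrC; exact: le_trans (mono _ _ ji) (tri _ _ _).
  - by rewrite ij subrr normr0 expr0n addr_ge0.
have pz : p @ \oo --> z.
  have -> : p = (fun n => z - lam n *: th n) by apply/funext => n.
  rewrite -[X in _ --> X]subr0 -(scale0r v).
  apply: cvgB; first exact: cvg_cst.
  by apply: cvgZ => //; exact: cvg_harmonic.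
exists v => y; rewrite -EFinD lee_fin.
have Fp : (F \o p) @ \oo --> F z.
  by apply: continuous_cvg => //; exact: (lipschitz_continuous_fun lF).
have lim : (fun n => F (p n) + inner (th n) (y - p n)) @ \oo
    --> F z + inner v (y - z).
  apply: cvgD; first exact: Fp.
  apply: cvg_inner; first exact: thv.
  by apply: cvgB; [exact: cvg_cst|exact: pz].
apply: (cvgr_to_le lim).
by apply: nearW => n; exact: sub.
Qed.

(** A subgradient z of the linear function l at 0 satisfies <z, w> <= l w for w
    and for - w, hence it represents l. *)
Lemma riesz_inner (l : X -> R) (M : R) (v : X) :
    (forall a u w, l (a *: u + w) = a * l u + l w) ->
    0 <= M -> (forall u, `|l u| <= M * `|u|) ->
  inner (riesz l) v = l v.
Proof.
move=> ll M0 lM.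
have l0 : l 0 = 0 by have := ll 1 0 0; rewrite scaler0 addr0 mul1r; lra.
have lB u w : l (u - w) = l u - l w.
  by rewrite addrC -scaleN1r ll mulN1r addrC.
have lZ a u : l (a *: u) = a * l u by rewrite -[a *: u]addr0 ll l0 addr0.
have [|||z hz] := @lipschitz_convex_subdifferential l M 0 => //.
- apply/convex_functionTP => x y s _.
  by rewrite ll lZ.
- by move=> x y; rewrite -lB.
have zl w : inner z w <= l w.
  by have := hz w; rewrite -EFinD lee_fin l0 add0r subr0.
suff zP : [set z | forall v, inner z v = l v] z.
  exact: (xgetPex 0 (ex_intro _ z zP)).
move=> w /=; apply/eqP; rewrite eq_le zl /=.
have := zl (- w); rewrite innerNr -[- w]sub0r lB l0; lra.
Qed.

End LipschitzConvex.

(** * Bounded operators and the subdifferential chain rule *)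

Section ChainRule.
Context {R : realType} {X Y : hilbertType R}.

Lemma has_sup_opnorm (A : {linear X -> Y}) : continuous A ->
  has_sup [set `|A x| | x in [set x : X | `|x| <= 1]].
Proof.
move=> /linear_bounded_continuous /linear_boundedP /pinfty_ex_gt0[M M0 hM].
split; first by exists `|A 0|, 0 => //=; rewrite normr0.
exists M => _ [x /= x1 <-]; apply: le_trans (hM x) _.
by rewrite -[leRHS]mulr1 ler_wpM2l// ltW.
Qed.

Lemma opnorm_ge0 (A : {linear X -> Y}) : continuous A -> 0 <= opnorm A.
Proof.
move=> cA; apply: sup_upper_bound; first exact: has_sup_opnorm.
by exists 0; rewrite /= ?linear0 normr0.
Qed.

Lemma opnorm_ub (A : {linear X -> Y}) (v : X) : continuous A ->
  `|A v| <= opnorm A * `|v|.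
Proof.
move=> cA.
have [->|v0] := eqVneq v 0; first by rewrite linear0 !normr0 mulr0.
have nv0 : 0 < `|v| by rewrite normr_gt0.
rewrite -ler_pdivrMr//; apply: sup_upper_bound; first exact: has_sup_opnorm.
exists (`|v|^-1 *: v) => /=.
  by rewrite normrZ normfV normr_id mulVf// gt_eqF.
by rewrite linearZ normrZ normfV normr_id mulrC.
Qed.

Lemma adjoint_inner (A : {linear X -> Y}) (y : Y) (v : X) : continuous A ->
  inner (adjoint A y) v = inner (A v) y.
Proof.
move=> cA; have opA := opnorm_ub _ cA.
have op0 : 0 <= opnorm A * `|y| by rewrite mulr_ge0// opnorm_ge0.
apply: (@riesz_inner _ _ (fun x => inner (A x) y) (opnorm A * `|y|)) => //.
  by move=> a u w; rewrite linearP innerDl innerZl.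
move=> u; rewrite mulrAC; apply: le_trans (ler_wpM2r (normr_ge0 y) (opA u)).
rewrite ler_norml inner_le_norm andbT lerNl -innerNl.
by apply: le_trans (inner_le_norm _ _) _; rewrite normrN.
Qed.

(** The last hypothesis says that z is a subgradient at x of the sum of G and
    of w |-> F (y + A (w - x)).  The perturbation function q v is the infimum
    over w of that sum, minus <z, w - x>, when the argument of F is shifted by v;
    the Lipschitz continuity of F stands for the usual qualification
    condition. *)
Lemma subdifferential_chain (F : Y -> R) (G : X -> \bar R) (A : {linear X -> Y})
    (M : R) (x z : X) (y : Y) :
    convex_function [set: convex_lmodType Y] F ->
    0 <= M -> (forall u v, `|F u - F v| <= M * `|u - v|) ->
    eproper G -> econvex G -> continuous A -> edom G x ->
    (forall w, edom G w -> F y + fine (G x) + inner z (w - x) <=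
                           F (y + A (w - x)) + fine (G w)) ->
  exists2 th, subdifferential (EFin \o F) y th &
    subdifferential G x (z - adjoint A th).
Proof.
move=> cF M0 lF pG cG cA dx opt.
pose h v w := F (y + v + A (w - x)) + fine (G w) - inner z (w - x).
pose S v := [set h v w | w in edom G].
pose q v := inf (S v).
pose c := F y + fine (G x).
have lbh v w : edom G w -> c - M * `|v| <= h v w.
  move=> dw; have := opt w dw.
  have := lF (y + A (w - x)) (y + v + A (w - x)).
  have -> : y + A (w - x) - (y + v + A (w - x)) = - v.
    by rewrite [y + v]addrC -[v + _ + _]addrA opprD addrCA subrr addr0.
  rewrite normrN => /(le_trans (ler_norm _)); rewrite /c /h; lra.
have infS v : has_inf (S v).
  split; first by exists (h v x), x.
  by exists (c - M * `|v|) => _ [w dw <-]; exact: lbh.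
have qle v w : edom G w -> q v <= h v w.
  by move=> dw; apply: ge_inf; [exact: (infS v).2|exists w].
have leq v r : (forall w, edom G w -> r <= h v w) -> r <= q v.
  move=> hr; apply: lb_le_inf; first exact: (infS v).1.
  by move=> _ [w dw <-]; exact: hr.
have lq u v : `|q u - q v| <= M * `|u - v|.
  have half a b : q a - q b <= M * `|a - b|.
    rewrite lerBlDr -lerBlDl; apply: leq => w dw.
    rewrite lerBlDl; apply: le_trans (qle a w dw) _.
    have := le_trans (ler_norm _) (lF (y + a + A (w - x)) (y + b + A (w - x))).
    have -> : y + a + A (w - x) - (y + b + A (w - x)) = a - b.
      by rewrite opprD addrACA subrr addr0 opprD addrACA subrr add0r.
    by rewrite /h; lra.
  rewrite ler_norml half andbT lerNl opprB distrC; exact: half.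
have cq : convex_function [set: convex_lmodType Y] q.
  apply/convex_functionTP => u v s s01; have /andP[s0 s1] := s01.
  apply/ler_addgt0Pl => e e0.
  have [_ [w1 dw1 <-] h1] := inf_adherent e0 (infS u).
  have [_ [w2 dw2 <-] h2] := inf_adherent e0 (infS v).
  have [dw hw] := econvex_edom pG cG dw1 dw2 s01.
  apply: le_trans (qle _ _ dw) _.
  have t0 : 0 <= 1 - s by rewrite subr_ge0.
  have := ler_wpM2l s0 (ltW h1); have := ler_wpM2l t0 (ltW h2).
  rewrite -!/(q _) /h.
  have -> : s *: w1 + (1 - s) *: w2 - x = s *: (w1 - x) + (1 - s) *: (w2 - x).
    by rewrite !scalerBr addrACA -opprD -scalerDl (addrC s) subrK scale1r.
  move/convex_functionTP : cF.
  move=> /(_ (y + u + A (w1 - x)) (y + v + A (w2 - x)) s s01).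
  have -> : s *: (y + u + A (w1 - x)) + (1 - s) *: (y + v + A (w2 - x)) =
     y + (s *: u + (1 - s) *: v) + A (s *: (w1 - x) + (1 - s) *: (w2 - x)).
    rewrite linearP [A (_ *: _)]linearZ /= !(scalerDr _ (y + _)) addrACA.
    congr (_ + _); rewrite !scalerDr.
    by rewrite addrACA -scalerDl (addrC s) subrK scale1r.
  by rewrite (innerDr z (s *: _)) !innerZr; lra.
have [th hth] := lipschitz_convex_subdifferential 0 cq M0 lq.
have {}hth v : c + inner th v <= q v.
  have := hth v; rewrite -EFinD lee_fin subr0; apply: le_trans.
  rewrite lerD2r; apply: leq => w dw.
  by have := lbh 0 w dw; rewrite normr0 mulr0 subr0.
(* The inequality hth at v = w - y and the point x gives the subgradient of F;
   at v = - A (w - x) and the point w it gives the one of G. *)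
exists th => [w|w].
  rewrite -EFinD lee_fin.
  have := le_trans (hth (w - y)) (qle (w - y) x dx).
  by rewrite /h /c subrr linear0 inner0r addr0 [y + _]addrC subrK; lra.
have [dw|] := pselect (edom G w); last first.
  by rewrite /edom /= ltey => /negP; rewrite negbK => /eqP->; rewrite leey.
rewrite (edom_fineK pG dx) (edom_fineK pG dw) -EFinD lee_fin.
have := le_trans (hth (- A (w - x))) (qle _ w dw).
rewrite /h /c subrK innerNr innerDl innerNl adjoint_inner// (innerC th); lra.
Qed.

End ChainRule.

(** * Passage to the limit *)

Section Limits.
Context {R : realType} {T : Type} (F : set_system T) {FF : ProperFilter F}.

Lemma cvg_dist_le {V : normedModType R} (u : T -> V) (l : V) (e : T -> R) :
    e @ F --> 0 -> (\forall k \near F, `|u k - l| <= e k) -> u @ F --> l.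
Proof.
move=> e0 ue; apply/cvgrPdist_le => d d0.
have ed : \forall k \near F, e k < d by apply: (cvgr_lt 0).
near=> k; rewrite distrC; apply: (@le_trans _ _ (e k)); first by near: k.
by apply: ltW; near: k.
Unshelve. all: by end_near. Qed.

Lemma cvg_operator {V W : normedModType R} (An : T -> V -> W) (A : V -> W)
    (e : T -> R) (u : T -> V) (v : V) :
    continuous A -> e @ F --> 0 ->
    (\forall k \near F, forall w, `|An k w - A w| <= e k * `|w|) ->
    u @ F --> v -> (fun k => An k (u k)) @ F --> A v.
Proof.
move=> cA e0 eA uv.
have -> : (fun k => An k (u k)) = (fun k => (An k (u k) - A (u k)) + A (u k)).
  by apply/funext => k; rewrite subrK.
rewrite -[A v]add0r; apply: cvgD.
  apply: (@cvg_dist_le _ _ _ (fun k => e k * `|u k|)).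
    by rewrite -(mul0r `|v|); apply: cvgM => //; exact: cvg_norm.
  by near=> k; rewrite subr0; near: k; apply: filterS eA => k; exact.
by apply: continuous_cvg => //; exact: cA.
Unshelve. all: by end_near. Qed.

Context {X Y : hilbertType R}.

(** Since phi0 is only lower semicontinuous, phi0 (p k) is first replaced by an
    arbitrary real a < phi0 xl, eventually below it.  As the right-hand side is
    finite at some point of the domain, this bounds such a, so that
    xl is in the domain as well. *)
Lemma composite_optimality_limit (phi0 : X -> \bar R) (phi1 : Y -> R)
    (x p s g : T -> X) (b : T -> Y) (An : T -> X -> Y)
    (xl gl : X) (bl : Y) (A : X -> Y) :
    eproper phi0 -> lower_semicontinuous phi0 -> continuous phi1 ->
    A 0 = 0 ->
    x @ F --> xl -> p @ F --> xl -> s @ F --> 0 -> g @ F --> gl ->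
    b @ F --> bl ->
    (forall (u : T -> X) (v : X), u @ F --> v ->
      (fun k => An k (u k)) @ F --> A v) ->
    (\forall k \near F, edom phi0 (p k) /\ forall w, edom phi0 w ->
       phi1 (An k (p k - x k) + b k) + fine (phi0 (p k)) +
         inner (s k - g k) (w - p k)
       <= phi1 (An k (w - x k) + b k) + fine (phi0 w)) ->
  edom phi0 xl /\ forall w, edom phi0 w ->
    phi1 bl + fine (phi0 xl) + inner (- gl) (w - xl)
    <= phi1 (bl + A (w - xl)) + fine (phi0 w).
Proof.
move=> pp lp cphi1 A0 xxl pxl s0 ggl bbl AnA opt.
have key (a : R) w : (a%:E < phi0 xl)%E -> edom phi0 w ->
    phi1 bl + a + inner (- gl) (w - xl)
    <= phi1 (bl + A (w - xl)) + fine (phi0 w).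
  move=> /lp[V xlV hV] dw.
  have lhs : (fun k => phi1 (An k (p k - x k) + b k) + a +
      inner (s k - g k) (w - p k)) @ F --> phi1 bl + a + inner (- gl) (w - xl).
    apply: cvgD; last first.
      apply: cvg_inner; last by apply: cvgB => //; exact: cvg_cst.
      by rewrite -[- gl]add0r; exact: cvgB.
    apply: cvgD; last exact: cvg_cst.
    rewrite -[in phi1 bl](add0r bl) -A0 -(subrr xl).
    apply: continuous_cvg; first exact: cphi1.
    by apply: cvgD => //; apply: AnA; exact: cvgB.
  have rhs : (fun k => phi1 (An k (w - x k) + b k) + fine (phi0 w)) @ F -->
      phi1 (bl + A (w - xl)) + fine (phi0 w).
    apply: cvgD; last exact: cvg_cst.
    rewrite [bl + _]addrC; apply: continuous_cvg; first exact: cphi1.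
    by apply: cvgD => //; apply: AnA; apply: cvgB => //; exact: cvg_cst.
  rewrite -subr_ge0; apply: (cvgr_to_ge (cvgB rhs lhs)).
  have Vp : \forall k \near F, V (p k) by exact: pxl.
  apply: filterS2 opt Vp => k [dp /(_ w dw) hk] Vk.
  rewrite subr_ge0; apply: le_trans hk; rewrite lerD2r lerD2l.
  by have := hV _ Vk; rewrite (edom_fineK pp dp) lte_fin => /ltW.
have dxl : edom phi0 xl.
  rewrite /edom /= ltey; apply/eqP => xlE; have [_ [d dd]] := pp.
  have := key (phi1 (bl + A (d - xl)) + fine (phi0 d) - phi1 bl -
    inner (- gl) (d - xl) + 1) d.
  by rewrite xlE ltry => /(_ isT dd); lra.
split=> // w dw; apply/ler_addgt0Pl => e e0.
have := key (fine (phi0 xl) - e) w.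
by rewrite [ltRHS](edom_fineK pp dxl) lte_fin gtrBl => /(_ e0 dw); lra.
Qed.

End Limits.

(** * Iterates of the algorithm and convergence *)

Section TrustRegionRun.
Context {R : realType} {X Y : hilbertType R}.
Context (P : problem X Y) (c : tr_constants R) (r : tr_run X Y).
Context (U V : set X) (Mf0 Mphi1 Mf1 klb : R).
Context (hP : standing_assumptions P U V Mf0 Mphi1 Mf1 klb).
Context (hr : tr_generated P c r).

(** An accepted trial point is in the domain because its model decrease is
    bounded below by a real number. *)
Lemma iterate_edom k : (0 < k)%N -> edom (phi0 P) (x_ r k).
Proof.
have pp := phi0_proper hP.
case: k => // k _; elim: k => [|k dk]; first exact: init_dom hr.
have it := iteration hr (ltn0Sn k).
have [rej|acc] := ltP (rho P r k.+1) (eta1 c).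
  by have [-> _] := update_reject it rej.
rewrite (update_accept it acc) /edom /= ltey; apply/eqP => xpE.
have := model_decrease it.
rewrite /predred /model /psi_model xpE (edom_fineK pp dk) -!EFinD.
by rewrite !addey// leeNy_eq.
Qed.

Lemma phi1_dist u v : `|phi1 P u - phi1 P v| <= Mphi1 * `|u - v|.
Proof. exact: (phi1_lipschitz hP (conj I I : (setT `*` setT) (u, v))). Qed.

Lemma lin_model_affine k (u v : X) (s : R) :
  lin_model r k (s *: u + (1 - s) *: v)
  = s *: lin_model r k u + (1 - s) *: lin_model r k v.
Proof.
rewrite /lin_model.
have -> : s *: u + (1 - s) *: v - x_ r k =
    s *: (u - x_ r k) + (1 - s) *: (v - x_ r k).
  by rewrite !scalerBr addrACA -opprD -scalerDl (addrC s) subrK scale1r.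
rewrite linearP [A_ r k (_ *: _)]linearZ /= !(scalerDr _ (A_ r k _)) addrACA.
by rewrite -scalerDl (addrC s) subrK scale1r.
Qed.

(** The stationarity measure h_k controls both the distance from x_k to the
    proximal point p and the residual (x_k - p) / t_k, which becomes a
    subgradient of psi_k at p once g_k is subtracted. *)
Lemma prox_step k : (0 < k)%N ->
  exists p, [/\ `|x_ r k - p| = t_ r k * hmeas P r k,
    edom (phi0 P) p &
    forall w, edom (phi0 P) w ->
      phi1 P (lin_model r k p) + fine (phi0 P p)
        + inner ((t_ r k)^-1 *: (x_ r k - p) - g_ r k) (w - p)
      <= phi1 P (lin_model r k w) + fine (phi0 P w)].
Proof.
move=> k0; have it := iteration hr k0; have t0 := t_gt0 it.
have pp := phi0_proper hP.
have cl : continuous (fun x => phi1 P (lin_model r k x)).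
  move=> x; apply: continuous_cvg.
    exact: (lipschitz_continuous_fun phi1_dist).
  apply: cvgD; last exact: cvg_cst.
  apply: continuous_cvg; first exact: (A_bounded it).
  by apply: cvgB; [exact: cvg_id|exact: cvg_cst].
have ppsi : eproper (psi_model P r k).
  exact: (eproper_addl (fun x => phi1 P (lin_model r k x)) pp).
have lpsi : lower_semicontinuous (psi_model P r k).
  exact: lsc_addl cl (phi0_closed hP).
have cpsi : econvex (psi_model P r k).
  apply: econvex_addl => //; last exact: phi0_convex hP.
  move=> u v s s01; rewrite lin_model_affine.
  by have /convex_functionTP := phi1_convex hP; apply.
pose z := x_ r k - t_ r k *: g_ r k.
pose p := prox (fun x => (t_ r k)%:E * psi_model P r k x)%E z.
have := prox_subdifferential z (eproper_scale t0 ppsi)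
  (lsc_scale t0 lpsi) (econvex_scale t0 ppsi cpsi).
rewrite -/p.
have -> : z - p = t_ r k *: ((t_ r k)^-1 *: (x_ r k - p) - g_ r k).
  by rewrite scalerBr scalerA divff ?gt_eqF// scale1r /z addrAC.
move=> /(subdifferential_scale _ _ _ t0) sub.
have dp : edom (phi0 P) p.
  have := subdifferential_edom ppsi sub; rewrite /edom /= /psi_model.
  by case: (phi0 P p) => [a _| |] //; rewrite ltry.
exists p; split => //.
  by rewrite /hmeas -/z -/p distrC mulrA divff ?gt_eqF// mul1r.
move=> w dw; have := sub w; rewrite /psi_model.
by rewrite (edom_fineK pp dp) (edom_fineK pp dw) -!EFinD lee_fin.
Qed.

End TrustRegionRun.

(** Limits along an infinite index set are taken along a proper filter, which is
    what passing to the limit in inequalities requires. *)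
Lemma within_eventually_proper (K : set nat) :
  infinite_set K -> ProperFilter (within K \oo).
Proof.
move=> iK; apply: Build_ProperFilter_ex => A [N _ NA].
apply: contrapT => /forallNP nA; apply: iK.
apply: (@sub_finite_set _ _ `I_N); last exact: finite_II.
move=> k Kk /=; rewrite ltnNge; apply/negP => Nk.
exact: nA k (NA k Nk Kk).
Qed.

Theorem theorem14 (R : realType) (X Y : hilbertType R) (P : problem X Y)
    (U V : set X) (Mf0 Mphi1 Mf1 klb : R)
    (c : tr_constants R) (r : tr_run X Y)
    (xbar : X) (K : set nat) (tmax : R)
    (hP : standing_assumptions P U V Mf0 Mphi1 Mf1 klb)
    (hr : tr_generated P c r)
    (hB : (\sum_(1 <= k <oo)
        ((1 + \big[Num.max/0]_(1 <= j < k.+1) opnorm (B_ r j))^-1)%:E)%E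
      = +oo%E)
    (hxbar : (U `&` V) xbar)
    (hK : infinite_set K)
    (hh : hmeas P r @ within K \oo --> 0)
    (hx : x_ r @ within K \oo --> xbar)
    (htmax : 0 < tmax)
    (ht : forall k : nat, (0 < k)%N -> t_ r k <= tmax) :
  stationary P xbar /\
  forall t : R, 0 < t ->
    exists2 theta, subdifferential (EFin \o phi1 P) (f1 P xbar) theta &
      xbar = prox (fun x => t%:E * phi0 P x)%E
        (xbar - t *: (gradient (f0 P) xbar + adjoint ('d (f1 P) xbar) theta)).
Proof.
have FF := within_eventually_proper hK.
set F := within K \oo in hh hx FF.
have [Uxbar Vxbar] := hxbar.
have cv := constants_valid hr.
have F_gt0 : \forall k \near F, (0 < k)%N.
  by apply: cvg_within; exact: nbhs_infty_gt.
have h_ge0 k : (0 < k)%N -> 0 <= hmeas P r k.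
  by move=> k0; rewrite mulr_ge0// invr_ge0 ltW// (t_gt0 (iteration hr k0)).
have dist0 : (fun k => `|x_ r k - xbar|) @ F --> 0.
  rewrite -(normr0 X) -(subrr xbar); apply: cvg_norm.
  by apply: cvgB => //; exact: cvg_cst.
have Mh (M : R) : (fun k => M * hmeas P r k) @ F --> 0.
  by rewrite -(mulr0 M); apply: cvgM => //; exact: cvg_cst.
have Mdist (M : R) : (fun k => M * `|x_ r k - xbar|) @ F --> 0.
  by rewrite -(mulr0 M); apply: cvgM => //; exact: cvg_cst.
have g_cvg : g_ r @ F --> gradient (f0 P) xbar.
  apply: (cvg_dist_le
    (e := fun k => kgrad c * hmeas P r k + Mf0 * `|x_ r k - xbar|)).
    by rewrite -[X in _ --> X]addr0; exact: cvgD.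
  apply: filterS F_gt0 => k k0; rewrite -(subrKA (gradient (f0 P) (x_ r k))).
  apply: le_trans (ler_normD _ _) _; apply: lerD.
    apply: le_trans (grad_error (iteration hr k0)) _.
    by rewrite ler_wpM2l ?(ltW (kgrad_gt0 cv))// ge_min lexx.
  have Uk : U (x_ r k) by apply: (dom_sub_U hP); exact: (iterate_edom hP hr).
  exact: (f0_lipschitz hP (conj Uk Uxbar : (U `*` U) (x_ r k, xbar))).
have b_cvg : b_ r @ F --> f1 P xbar.
  have -> : b_ r = (fun k => (b_ r k - f1 P (x_ r k)) + f1 P (x_ r k)).
    by apply/funext => k; rewrite subrK.
  rewrite -[f1 P xbar]add0r; apply: cvgD.
    apply: (cvg_dist_le (Mh (kval c))).
    apply: filterS F_gt0 => k k0; rewrite subr0.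
    apply: le_trans (val_error (iteration hr k0)) _.
    by rewrite ler_wpM2l ?(ltW (kval_gt0 cv))// ge_min lexx.
  apply: continuous_cvg => //.
  exact: (differentiable_continuous (f1_differentiable hP Vxbar)).
have cd x : V x -> continuous ('d (f1 P) x).
  by move=> Vx; apply: diff_continuous; exact: (f1_differentiable hP Vx).
have A_cvg (u : nat -> X) v : u @ F --> v ->
    (fun k => A_ r k (u k)) @ F --> 'd (f1 P) xbar v.
  move=> uv; apply: (@cvg_operator _ _ F FF X Y (fun k => A_ r k)
    ('d (f1 P) xbar)
    (fun k => kjac c * hmeas P r k + Mf1 * `|x_ r k - xbar|) u v _ _ _ uv).
  - exact: cd.
  - by rewrite -[X in _ --> X]addr0; exact: cvgD.
  apply: filterS F_gt0 => k k0 w; have it := iteration hr k0.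
  have Vk : V (x_ r k) by apply: (dom_sub_V hP); exact: (iterate_edom hP hr).
  rewrite -(subrKA ('d (f1 P) (x_ r k) w)).
  apply: le_trans (ler_normD _ _) _; rewrite mulrDl; apply: lerD.
    have cAd : continuous (A_ r k \- 'd (f1 P) (x_ r k)).
      by move=> x; apply: cvgB; [exact: (A_bounded it)|exact: cd].
    apply: le_trans (opnorm_ub w cAd) _; rewrite ler_wpM2r//.
    apply: le_trans (jac_error it) _.
    by rewrite ler_wpM2l ?(ltW (kjac_gt0 cv))// ge_min lexx.
  have cdd : continuous ('d (f1 P) (x_ r k) \- 'd (f1 P) xbar).
    by move=> x; apply: cvgB; exact: cd.
  apply: le_trans (opnorm_ub w cdd) _; rewrite ler_wpM2r//.
  exact: f1_lipschitz hP _ _ Vk Vxbar.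
have /choice[p hp] : forall k, exists p, (0 < k)%N ->
  [/\ `|x_ r k - p| = t_ r k * hmeas P r k, edom (phi0 P) p &
    forall w, edom (phi0 P) w ->
      phi1 P (lin_model r k p) + fine (phi0 P p)
        + inner ((t_ r k)^-1 *: (x_ r k - p) - g_ r k) (w - p)
      <= phi1 P (lin_model r k w) + fine (phi0 P w)].
  (* Index 0 does not belong to the run: any point will do there. *)
  move=> k; have [->|k0] := posnP k; first by exists 0.
  by have [p hp] := prox_step hP hr k0; exists p.
have p_cvg : p @ F --> xbar.
  apply: (cvg_dist_le (e := fun k => tmax * hmeas P r k + `|x_ r k - xbar|)).
    by rewrite -[X in _ --> X]addr0; exact: cvgD.
  apply: filterS F_gt0 => k k0; rewrite -(subrKA (x_ r k)).
  apply: le_trans (ler_normD _ _) _; rewrite lerD2r distrC.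
  by have [-> _ _] := hp k k0; rewrite ler_wpM2r ?h_ge0// ht.
have s_cvg : (fun k => (t_ r k)^-1 *: (x_ r k - p k)) @ F --> (0 : X).
  apply: (cvg_dist_le hh); apply: filterS F_gt0 => k k0.
  have t0 := t_gt0 (iteration hr k0).
  rewrite subr0 normrZ gtr0_norm ?invr_gt0//.
  by have [-> _ _] := hp k k0; rewrite mulrA mulVf ?gt_eqF// mul1r.
have p_opt : \forall k \near F, edom (phi0 P) (p k) /\
    forall w, edom (phi0 P) w ->
      phi1 P (A_ r k (p k - x_ r k) + b_ r k) + fine (phi0 P (p k))
        + inner ((t_ r k)^-1 *: (x_ r k - p k) - g_ r k) (w - p k)
      <= phi1 P (A_ r k (w - x_ r k) + b_ r k) + fine (phi0 P w).
  by apply: filterS F_gt0 => k k0; have [] := hp k k0.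
have [dxbar opt] := composite_optimality_limit (An := fun k => A_ r k)
  (phi0_proper hP) (phi0_closed hP) (lipschitz_continuous_fun (phi1_dist hP))
  (linear0 ('d (f1 P) xbar)) hx p_cvg s_cvg g_cvg b_cvg A_cvg p_opt.
have [th th1 th0] := subdifferential_chain (phi1_convex hP)
  (ltW (Mphi1_gt0 hP)) (phi1_dist hP) (phi0_proper hP) (phi0_convex hP)
  (cd xbar Vxbar) dxbar opt.
rewrite -opprD in th0; split; first by exists th.
move=> t t0; exists th => //.
rewrite -scalerN subdifferential_prox//.
  exact: eproper_scale (phi0_proper hP).
by apply/subdifferential_scale.
Qed.
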